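(* The entailment problem of $\{r, s, r^*, s^*, r^{\#}s^{\#}\}$-conjunctive queries over $\mathcal{ALC}$-TBoxes is undecidable, where $r,s$ are fixed role names and $r^{\#}s^{\#}:=\{r^ns^n\mid n\in\mathbb{N}\}$.
   Context: An $\mathcal{ALC}$-TBox is a finite set of general concept inclusions $C\sqsubseteq D$ between $\mathcal{ALC}$-concepts (built from $\top$, concept names, $\neg$, $\sqcap$, $\exists p.C$); $\mathcal{I}$ satisfies it if $C^{\mathcal{I}}\subseteq D^{\mathcal{I}}$ for each inclusion. For a class $\mathbb{C}$ of languages over role names, a $\mathbb{C}$-conjunctive query is a finite conjunction of atoms $A(x)$ ($A$ a concept name), $p(x,y)$ ($p$ a role name) and $\mathcal{L}(x,y)$ ($\mathcal{L}\in\mathbb{C}$), over variables. $\mathcal{I}$ satisfies a query $q$ if there is an assignment $\eta$ of its variables to domain elements making every atom true, where $\mathcal{L}(x,y)$ holds iff $\eta(y)$ is reachable from $\eta(x)$ along a sequence of edges whose roles spell a word of $\mathcal{L}$. A TBox $\mathcal{T}$ entails $q$ if every model of $\mathcal{T}$ satisfies $q$. The entailment problem asks, given $\mathcal{T}$ and $q$, whether $\mathcal{T}$ entails $q$. *)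

(* Defs.v *)
From mathcomp Require Import all_boot.
From Stdlib Require List.
Unset Printing Implicit Defensive.

Definition role := nat.
Definition cname := nat.
Definition role_r : role := 0.
Definition role_s : role := 1.

Inductive concept : Type :=
| CTop : concept
| CName : cname -> concept
| CNeg : concept -> concept
| CAnd : concept -> concept -> concept
| CEx : role -> concept -> concept.

(* A GCI C ⊑ D is a pair (C, D); a TBox is a finite list of GCIs. *)
Definition gci := (concept * concept)%type.
Definition tbox := seq gci.

Inductive lang : Type := LR | LS | LRstar | LSstar | LRnSn.

Definition word := seq role.

Definition in_lang (L : lang) (w : word) : Prop :=
  match L with
  | LR => w = [:: role_r]
  | LS => w = [:: role_s]
  | LRstar => exists n, w = nseq n role_r
  | LSstar => exists n, w = nseq n role_s
  | LRnSn => exists n, w = nseq n role_r ++ nseq n role_s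
  end.

(* Query variables are natural numbers. *)
Inductive atom : Type :=
| AConc : cname -> nat -> atom
| ARole : role -> nat -> nat -> atom
| ALang : lang -> nat -> nat -> atom.

Definition query := seq atom.

Record interp : Type := Interp {
  dom : Type;
  dom_inhabited : inhabited dom;
  cI : cname -> dom -> Prop;
  rI : role -> dom -> dom -> Prop }.

Fixpoint csem (I : interp) (C : concept) : dom I -> Prop :=
  match C with
  | CTop => fun _ => True
  | CName A => cI I A
  | CNeg C => fun d => ~ csem I C d
  | CAnd C D => fun d => csem I C d /\ csem I D d
  | CEx p C => fun d => exists e, rI I p d e /\ csem I C e
  end.

Definition sat_tbox (I : interp) (T : tbox) : Prop :=
  forall g, List.In g T -> forall d, csem I g.1 d -> csem I g.2 d.

Fixpoint reach (I : interp) (w : word) : dom I -> dom I -> Prop :=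
  match w with
  | [::] => fun d e => d = e
  | p :: w' => fun d e => exists d', rI I p d d' /\ reach I w' d' e
  end.

Definition atom_holds (I : interp) (eta : nat -> dom I) (a : atom) : Prop :=
  match a with
  | AConc A x => cI I A (eta x)
  | ARole p x y => rI I p (eta x) (eta y)
  | ALang L x y => exists w, in_lang L w /\ reach I w (eta x) (eta y)
  end.

Definition sat_query (I : interp) (q : query) : Prop :=
  exists eta : nat -> dom I, forall a, List.In a q -> atom_holds I eta a.

Definition entails (T : tbox) (q : query) : Prop :=
  forall I : interp, sat_tbox I T -> sat_query I q.

Definition cpair (n m : nat) : nat := ((n + m) * (n + m).+1)./2 + m.

Fixpoint enc_concept (C : concept) : nat :=
  match C with
  | CTop => cpair 0 0
  | CName A => cpair 1 A
  | CNeg C => cpair 2 (enc_concept C)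
  | CAnd C D => cpair 3 (cpair (enc_concept C) (enc_concept D))
  | CEx p C => cpair 4 (cpair p (enc_concept C))
  end.

Definition enc_seq {T : Type} (f : T -> nat) (s : seq T) : nat :=
  foldr (fun x acc => (cpair (f x) acc).+1) 0 s.

Definition enc_lang (L : lang) : nat :=
  match L with LR => 0 | LS => 1 | LRstar => 2 | LSstar => 3 | LRnSn => 4 end.

Definition enc_atom (a : atom) : nat :=
  match a with
  | AConc A x => cpair 0 (cpair A x)
  | ARole p x y => cpair 1 (cpair p (cpair x y))
  | ALang L x y => cpair 2 (cpair (enc_lang L) (cpair x y))
  end.

Definition enc_gci (g : gci) : nat := cpair (enc_concept g.1) (enc_concept g.2).

Definition enc_instance (T : tbox) (q : query) : nat :=
  cpair (enc_seq enc_gci T) (enc_seq enc_atom q).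

Inductive instr : Type :=
| INC : nat -> instr
| DEC : nat -> nat -> instr.

Definition program := seq instr.
Definition mstate := (nat * (nat -> nat))%type.

Definition upd (f : nat -> nat) (r v : nat) : nat -> nat :=
  fun k => if k == r then v else f k.

Definition step (P : program) (st : mstate) : mstate :=
  let: (pc, regs) := st in
  match nth (INC 0) P pc with
  | INC r => if pc < size P then (pc.+1, upd regs r (regs r).+1) else st
  | DEC r j =>
      if pc < size P then
        (if regs r == 0 then (j, regs) else (pc.+1, upd regs r (regs r).-1))
      else st
  end.

Definition init_state (x : nat) : mstate := (0, fun k => if k == 0 then x else 0).

Definition halts_with (P : program) (x y : nat) : Prop :=
  exists n, let st := iter n (step P) (init_state x) in
            size P <= st.1 /\ st.2 0 = y.

Definition entailment_decidable : Prop :=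
  exists P : program, forall (T : tbox) (q : query),
    (entails T q -> halts_with P (enc_instance T q) 1) /\
    (~ entails T q -> halts_with P (enc_instance T q) 0).

(* Main.v *)
Require Import Defs.
From mathcomp Require Import all_boot.
From mathcomp Require Import zify.
From Stdlib Require Import Classical FunctionalExtensionality.

(** The proof is a diagonal argument. A register machine with [R] registers is
    simulated in a comb: an r-path whose [n]-th node starts an s-column, which
    stores register [(n - 1) mod R] as the distance between two marked cells;
    [R] consecutive columns form one machine step. Two paths spelling r^a s^a and
    r^b s^b with a common source on the r-path end in cells of the same height
    [n - m], where [m] is the depth in column [n]. So a single query can compare
    cells of equal height in columns [n] and [n + R]: it matches iff some mark
    predicted by column [n] is missing in column [n + R]. The TBox makes each
    column an automaton run with exactly two marks and two predicted marks, so
    the models without a match are the infinite runs of the machine.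

    Given a decider [P], the machine [diagonal P] reads the code [x] of a TBox
    [T0], computes the code of [T0] plus one inclusion that loads [x] into
    register 0, runs [P] on it, and halts iff [P] answers 0. Taking for [T0] the
    simulation of [diagonal P] itself gives a contradiction; the map from
    machines to TBoxes need not be computed by a machine. *)

(** * Register machine programs *)

Definition reaches (P : program) (st st' : mstate) : Prop :=
  exists n, iter n (step P) st = st'.

Lemma reaches_refl P st : reaches P st st.
Proof. by exists 0. Qed.

Lemma reaches_step P st st' : reaches P (step P st) st' -> reaches P st st'.
Proof. by case=> n <-; exists n.+1; rewrite iterSr. Qed.

Lemma reaches_trans P st1 st2 st3 :
  reaches P st1 st2 -> reaches P st2 st3 -> reaches P st1 st3.
Proof. by case=> n <- [m <-]; exists (m + n); rewrite iterD. Qed.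

Definition halts (P : program) (x : nat) : Prop :=
  exists n, size P <= (iter n (step P) (init_state x)).1.

Lemma step_halted P st : size P <= st.1 -> step P st = st.
Proof.
by case: st => pc f /= le_pc; case: nth => [r|r j]; rewrite ltnNge le_pc.
Qed.

Lemma iter_step_halted P st n : size P <= st.1 -> iter n (step P) st = st.
Proof. by move=> le_st; elim: n => //= n ->; rewrite step_halted. Qed.

Lemma reaches_halts P x st :
  reaches P (init_state x) st -> size P <= st.1 -> halts P x.
Proof. by case=> n <-; exists n. Qed.

(** A halted state is stationary, so a halting run would meet the fixed point [st] at a common later
    time. *)
Lemma reaches_loop P x st :
  reaches P (init_state x) st -> step P st = st -> st.1 < size P -> ~ halts P x.
Proof.
case=> n <- fix_st lt_st [m le_m]; set s0 := init_state x in fix_st lt_st le_m.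
have fix_iter k : iter k (step P) (iter n (step P) s0) = iter n (step P) s0.
  by elim: k => //= k ->.
have := fix_iter m; rewrite -iterD addnC iterD iter_step_halted // => eq_mn.
by move: le_m; rewrite eq_mn leqNgt lt_st.
Qed.

(** * Structured loop programs and their compilation *)

Inductive cmd : Type :=
| CSkip
| CInc of nat
| CSeq of cmd & cmd
| CLoop of nat & cmd.

(* [CLoop a c] is [while a > 0 { a := a - 1; c }]; memory cells past the end
   of the sequence hold 0. *)
Inductive exec : cmd -> seq nat -> seq nat -> Prop :=
| ExecSkip s : exec CSkip s s
| ExecInc a s : exec (CInc a) s (set_nth 0 s a (nth 0 s a).+1)
| ExecSeq c d s1 s2 s3 : exec c s1 s2 -> exec d s2 s3 -> exec (CSeq c d) s1 s3
| ExecLoop0 a c s : nth 0 s a = 0 -> exec (CLoop a c) s s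
| ExecLoopS a c v s1 s2 s3 : nth 0 s1 a = v.+1 ->
    exec c (set_nth 0 s1 a v) s2 -> exec (CLoop a c) s2 s3 ->
    exec (CLoop a c) s1 s3.

(** Compiled code keeps this register at 0, so [DEC zero_reg j] is an unconditional jump. *)
Definition zero_reg := 6.

Fixpoint avoids_zero_reg (c : cmd) : bool :=
  match c with
  | CSkip => true
  | CInc a => a != zero_reg
  | CSeq c d => avoids_zero_reg c && avoids_zero_reg d
  | CLoop a c => (a != zero_reg) && avoids_zero_reg c
  end.

Lemma exec_zero_reg c s s' :
  exec c s s' -> avoids_zero_reg c -> nth 0 s' zero_reg = nth 0 s zero_reg.
Proof.
elim=> {c s s'} //=.
- by move=> a s ne_a; rewrite nth_set_nth /= eq_sym (negPf ne_a).
- by move=> c d s1 s2 s3 _ IH1 _ IH2 /andP[c_ok d_ok]; rewrite IH2 ?IH1.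
move=> a c v s1 s2 s3 _ _ IH1 _ IH2 /andP[ne_a c_ok].
by rewrite IH2 ?ne_a // IH1 // nth_set_nth /= eq_sym (negPf ne_a).
Qed.

Fixpoint clen (c : cmd) : nat :=
  match c with
  | CSkip => 0
  | CInc a => 1
  | CSeq c d => clen c + clen d
  | CLoop a c => (clen c).+2
  end.

Fixpoint compile (off : nat) (c : cmd) : program :=
  match c with
  | CSkip => [::]
  | CInc a => [:: INC a]
  | CSeq c d => compile off c ++ compile (off + clen c) d
  | CLoop a c =>
      DEC a (off + (clen c).+2) :: compile off.+1 c ++ [:: DEC zero_reg off]
  end.

Lemma size_compile off c : size (compile off c) = clen c.
Proof.
elim: c off => //= [c IHc d IHd|a c IHc] off; rewrite size_cat ?IHc ?IHd //.
by rewrite addn1.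
Qed.

Lemma upd_nth s a v : upd (nth 0 s) a v = nth 0 (set_nth 0 s a v).
Proof. by apply: functional_extensionality => k; rewrite nth_set_nth. Qed.

Lemma step_cat pre i post f :
  step (pre ++ i :: post) (size pre, f) =
  match i with
  | INC r => ((size pre).+1, upd f r (f r).+1)
  | DEC r j => if f r == 0 then (j, f) else ((size pre).+1, upd f r (f r).-1)
  end.
Proof.
rewrite /step nth_cat ltnn subnn /= size_cat /=.
by have -> : size pre < size pre + (size post).+1 by lia.
Qed.

(** Jump targets are absolute, so the induction has to range over all surrounding code; [size pre]
    is the offset. *)
Lemma compile_exec c s s' : exec c s s' -> forall pre post,
  avoids_zero_reg c -> nth 0 s zero_reg = 0 ->
  reaches (pre ++ compile (size pre) c ++ post)
    (size pre, nth 0 s) (size pre + clen c, nth 0 s').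
Proof.
elim=> {c s s'} /=.
- by move=> s pre post _ _; rewrite addn0; apply: reaches_refl.
- move=> a s pre post _ _; apply: reaches_step.
  by rewrite step_cat upd_nth addn1; apply: reaches_refl.
- move=> c d s1 s2 s3 ex1 IH1 ex2 IH2 pre post /andP[c_ok d_ok] z0.
  rewrite -catA; apply: reaches_trans (IH1 _ _ c_ok z0) _.
  have := IH2 (pre ++ compile (size pre) c) post d_ok.
  rewrite size_cat size_compile addnA -catA; apply.
  by rewrite (exec_zero_reg _ _ _ ex1).
- move=> a c s a0 pre post _ _; apply: reaches_step.
  by rewrite step_cat a0; apply: reaches_refl.
move=> a c v s1 s2 s3 av ex1 IH1 ex2 IH2 pre post /andP[a_ok c_ok] z0.
have z1 : nth 0 (set_nth 0 s1 a v) zero_reg = 0.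
  by rewrite nth_set_nth /= eq_sym (negPf a_ok).
have z2 : nth 0 s2 zero_reg = 0 by rewrite (exec_zero_reg _ _ _ ex1).
apply: reaches_step; rewrite step_cat av /= upd_nth.
set I0 := DEC a _; set I1 := DEC zero_reg _.
have := IH1 (rcons pre I0) ([:: I1] ++ post) c_ok z1.
rewrite size_rcons cat_rcons => run; rewrite -catA.
apply: reaches_trans run _; apply: reaches_step.
set pre' := pre ++ I0 :: compile (size pre).+1 c.
have -> : pre ++ I0 :: compile (size pre).+1 c ++ [:: I1] ++ post
          = pre' ++ I1 :: post by rewrite /pre' -catA.
have -> : (size pre).+1 + clen c = size pre'.
  by rewrite size_cat /= size_compile addSnnS.
have -> : step (pre' ++ I1 :: post) (size pre', nth 0 s2) = (size pre, nth 0 s2).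
  by rewrite step_cat /I1 z2.
have := IH2 pre post; rewrite -/I0 -/I1 /pre' -!catA /=; apply=> //.
by rewrite a_ok.
Qed.

(** Truncating targets at [s] makes every way of halting arrive at the first instruction after the
    copy. *)
Definition reloc (off s : nat) (i : instr) : instr :=
  match i with INC r => INC r | DEC r j => DEC r (off + minn j s) end.

Lemma step_reloc pre P post pc f : pc < size P ->
  step (pre ++ map (reloc (size pre) (size P)) P ++ post) (size pre + pc, f) =
  (size pre + minn (step P (pc, f)).1 (size P), (step P (pc, f)).2).
Proof.
move=> lt_pc; rewrite /step nth_cat ltnNge leq_addr /= addKn nth_cat.
rewrite size_map lt_pc (nth_map (INC 0)) // !size_cat size_map.
have -> : size pre + pc < size pre + (size P + size post) by lia.
case: (nth (INC 0) P pc) => [r|r j] /=; first by congr pair; lia.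
by case: ifP => _ //=; congr pair; lia.
Qed.

Lemma reaches_reloc pre P post f n :
  let: st := iter n (step P) (0, f) in
  reaches (pre ++ map (reloc (size pre) (size P)) P ++ post)
    (size pre, f) (size pre + minn st.1 (size P), st.2).
Proof.
elim: n => [|n IHn]; first by rewrite /= min0n addn0; apply: reaches_refl.
rewrite iterS; case: (iter n (step P) (0, f)) IHn => pc g IHn.
case: (ltnP pc (size P)) => [lt_pc|le_pc]; last by rewrite step_halted.
apply: reaches_trans IHn _; apply: reaches_step.
rewrite (minn_idPl (ltnW lt_pc)) step_reloc //; exact: reaches_refl.
Qed.

(** * Programs that compute codes *)

Fixpoint load (a n : nat) : cmd :=
  if n is n'.+1 then CSeq (CInc a) (load a n') else CSkip.

(** Register 2 holds the first component [c] and register 1 the second, [y]. With [k = c + y], the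
    triangular number in [cpair] is summed in register 3 as [k + (k - 1) + ... + 1]; register 4
    restores the counter after each copy. *)
Definition pair_cmd : cmd :=
  CSeq (CLoop 1 (CSeq (CInc 2) (CInc 3)))
  (CSeq (CLoop 2 (CSeq (CInc 3)
           (CSeq (CLoop 2 (CSeq (CInc 3) (CInc 4))) (CLoop 4 (CInc 2)))))
        (CLoop 3 (CInc 1))).

Lemma exec_load1 x y c w t l z x' n :
  exec (load 1 n) [:: x; y; c; w; t; l; z; x'] [:: x; y + n; c; w; t; l; z; x'].
Proof.
elim: n y => [|n IHn] y /=; first by rewrite addn0; constructor.
by econstructor; [constructor | rewrite /= -addSnnS; apply: IHn].
Qed.

Lemma exec_load2 x y c w t l z x' n :
  exec (load 2 n) [:: x; y; c; w; t; l; z; x'] [:: x; y; c + n; w; t; l; z; x'].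
Proof.
elim: n c => [|n IHn] c /=; first by rewrite addn0; constructor.
by econstructor; [constructor | rewrite /= -addSnnS; apply: IHn].
Qed.

Ltac loop_step := eapply ExecLoopS; [by [] | |].
Ltac exec_incs := repeat (eapply ExecSeq); constructor.

Lemma exec_pair x y c l z x' :
  exec pair_cmd [:: x; y; c; 0; 0; l; z; x'] [:: x; cpair c y; 0; 0; 0; l; z; x'].
Proof.
have move_y w : exec (CLoop 1 (CSeq (CInc 2) (CInc 3)))
    [:: x; y; c; w; 0; l; z; x'] [:: x; 0; c + y; w + y; 0; l; z; x'].
  elim: y c w => [|n IHn] m w; first by rewrite !addn0; constructor.
  by loop_step; [exec_incs | rewrite /= -!addSnnS; apply: IHn].
have copy k w t : exec (CLoop 2 (CSeq (CInc 3) (CInc 4)))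
    [:: x; 0; k; w; t; l; z; x'] [:: x; 0; 0; w + k; t + k; l; z; x'].
  elim: k w t => [|k IHk] w t; first by rewrite !addn0; constructor.
  by loop_step; [exec_incs | rewrite /= -!addSnnS; apply: IHk].
have move_back k w u : exec (CLoop 4 (CInc 2))
    [:: x; 0; u; w; k; l; z; x'] [:: x; 0; u + k; w; 0; l; z; x'].
  elim: k u => [|k IHk] u; first by rewrite !addn0; constructor.
  by loop_step; [exec_incs | rewrite /= -!addSnnS; apply: IHk].
have move_w n v : exec (CLoop 3 (CInc 1))
    [:: x; v; 0; n; 0; l; z; x'] [:: x; v + n; 0; 0; 0; l; z; x'].
  elim: n v => [|n IHn] v; first by rewrite !addn0; constructor.
  by loop_step; [exec_incs | rewrite /= -!addSnnS; apply: IHn].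
apply: ExecSeq (move_y 0) _; rewrite add0n.
apply: (ExecSeq _ _ _ [:: x; 0; 0; cpair c y; 0; l; z; x']); last exact: move_w.
rewrite /cpair [_./2 + _]addnC; move: (c + y) => k.
elim: k y {move_y} => [|k IHk] w; first by rewrite !addn0; constructor.
loop_step; last first.
  (* One pass adds the largest summand [k.+1] of the triangular number. *)
  rewrite (_ : w + _ = (w + k.+1) + (k * k.+1)./2); first exact: IHk.
  have -> : k.+1 * k.+2 = k.+1.*2 + k * k.+1 by lia.
  by rewrite halfD odd_double doubleK add0n addnA.
apply: ExecSeq; first exact: ExecInc.
rewrite /= -addSnnS; apply: ExecSeq; first exact: copy.
exact: move_back.
Qed.

(** The innermost pair comes first; [pair_cmd] leaves register 2 at 0, ready for the next
    constant. *)
Fixpoint pairs_cmd (cs : seq nat) : cmd :=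
  if cs is c :: cs' then CSeq (pairs_cmd cs') (CSeq (load 2 c) pair_cmd)
  else CSkip.

Lemma exec_pairs cs x y l z x' :
  exec (pairs_cmd cs) [:: x; y; 0; 0; 0; l; z; x']
    [:: x; foldr cpair y cs; 0; 0; 0; l; z; x'].
Proof.
elim: cs => [|c cs IHcs] /=; first by constructor.
apply: ExecSeq IHcs _; apply: ExecSeq; first exact: exec_load2.
exact: exec_pair.
Qed.

(* Register 5 counts the [x] passes of the loop, register 7 keeps [x]. *)
Definition encoder_cmd (body pref : seq nat) (y0 cq : nat) : cmd :=
  foldr CSeq CSkip
    [:: CLoop 0 (CSeq (CInc 5) (CInc 7)); load 1 y0; CLoop 5 (pairs_cmd body);
        pairs_cmd pref; CLoop 1 (CInc 2); CLoop 7 (CInc 1); pair_cmd;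
        CInc 1; CLoop 1 (CInc 2); load 1 cq; pair_cmd; CLoop 1 (CInc 0)].

Lemma exec_move12 x y c l z x' :
  exec (CLoop 1 (CInc 2)) [:: x; y; c; 0; 0; l; z; x']
    [:: x; 0; c + y; 0; 0; l; z; x'].
Proof.
elim: y c => [|y IHy] c; first by rewrite addn0; constructor.
by loop_step; [exec_incs | rewrite /= -addSnnS; apply: IHy].
Qed.

(** All registers but 0 are cleared, so the decider that follows starts in one of its initial
    states. *)
Lemma exec_encoder body pref y0 cq x :
  exec (encoder_cmd body pref y0 cq) [:: x; 0; 0; 0; 0; 0; 0; 0]
    [:: cpair (cpair (foldr cpair (iter x (fun y => foldr cpair y body) y0) pref)
                     x).+1 cq; 0; 0; 0; 0; 0; 0; 0].
Proof.
have copy n l x' : exec (CLoop 0 (CSeq (CInc 5) (CInc 7)))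
    [:: n; 0; 0; 0; 0; l; 0; x'] [:: 0; 0; 0; 0; 0; l + n; 0; x' + n].
  elim: n l x' => [|n IHn] l x'; first by rewrite !addn0; constructor.
  by loop_step; [exec_incs | rewrite /= -!addSnnS; apply: IHn].
have wrap n y : exec (CLoop 5 (pairs_cmd body))
    [:: 0; y; 0; 0; 0; n; 0; x]
    [:: 0; iter n (fun y => foldr cpair y body) y; 0; 0; 0; 0; 0; x].
  elim: n y => [|n IHn] y; first by constructor.
  by loop_step; [exact: exec_pairs | rewrite iterSr; apply: IHn].
have move71 n y c : exec (CLoop 7 (CInc 1))
    [:: 0; y; c; 0; 0; 0; 0; n] [:: 0; y + n; c; 0; 0; 0; 0; 0].
  elim: n y => [|n IHn] y; first by rewrite addn0; constructor.
  by loop_step; [exec_incs | rewrite /= -addSnnS; apply: IHn].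
have move10 n a : exec (CLoop 1 (CInc 0))
    [:: a; n; 0; 0; 0; 0; 0; 0] [:: a + n; 0; 0; 0; 0; 0; 0; 0].
  elim: n a => [|n IHn] a; first by rewrite addn0; constructor.
  by loop_step; [exec_incs | rewrite /= -addSnnS; apply: IHn].
rewrite /encoder_cmd /=.
apply: ExecSeq (copy _ _ _) _; apply: ExecSeq (exec_load1 _ _ _ _ _ _ _ _ _) _.
apply: ExecSeq (wrap _ _) _; apply: ExecSeq (exec_pairs _ _ _ _ _ _) _.
apply: ExecSeq (exec_move12 _ _ _ _ _ _) _; apply: ExecSeq (move71 _ _ _) _.
apply: ExecSeq (exec_pair _ _ _ _ _ _) _; apply: ExecSeq (ExecInc _ _) _.
apply: ExecSeq (exec_move12 _ _ _ _ _ _) _.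
apply: ExecSeq (exec_load1 _ _ _ _ _ _ _ _ _) _.
apply: ExecSeq (exec_pair _ _ _ _ _ _) _; apply: ExecSeq (move10 _ _) _.
exact: ExecSkip.
Qed.

Lemma avoids_load a n : a != zero_reg -> avoids_zero_reg (load a n).
Proof. by move=> ne_a; elim: n => //= n ->; rewrite ne_a. Qed.

Lemma avoids_pairs cs : avoids_zero_reg (pairs_cmd cs).
Proof. by elim: cs => //= c cs ->; rewrite avoids_load. Qed.

Lemma avoids_encoder body pref y0 cq :
  avoids_zero_reg (encoder_cmd body pref y0 cq).
Proof. by rewrite /= !avoids_pairs !avoids_load. Qed.

(** * The diagonal machine *)

Definition instr_reg (i : instr) : nat :=
  match i with INC r => r | DEC r _ => r end.

Definition regs_below (R : nat) (P : program) : bool :=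
  all (fun i => instr_reg i < R) P.

Fixpoint cmd_regs_below (R : nat) (c : cmd) : bool :=
  match c with
  | CSkip => true
  | CInc a => a < R
  | CSeq c d => cmd_regs_below R c && cmd_regs_below R d
  | CLoop a c => (a < R) && cmd_regs_below R c
  end.

Lemma regs_below_compile R off c : zero_reg < R ->
  cmd_regs_below R c -> regs_below R (compile off c).
Proof.
rewrite /regs_below => z_lt.
elim: c off => //= [a off ->|c IHc d IHd off|a c IHc off] //.
  by case/andP=> c_lt d_lt; rewrite all_cat IHc ?IHd.
by case/andP=> -> c_lt; rewrite all_cat IHc //= z_lt.
Qed.

Lemma regs_below_encoder R body pref y0 cq : 8 <= R ->
  cmd_regs_below R (encoder_cmd body pref y0 cq).
Proof.
move=> R_ge; have lt_R a : a < 8 -> a < R by move=> /leq_trans; apply.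
have load_lt a n : a < 8 -> cmd_regs_below R (load a n).
  by move=> lt_a; elim: n => //= n ->; rewrite lt_R.
have pairs_lt cs : cmd_regs_below R (pairs_cmd cs).
  by elim: cs => //= c cs ->; rewrite load_lt // !lt_R.
by rewrite /= !pairs_lt !load_lt // !lt_R.
Qed.

Lemma regs_below_reloc R off s P :
  regs_below R (map (reloc off s) P) = regs_below R P.
Proof. by rewrite /regs_below all_map; apply: eq_all => -[]. Qed.

Lemma ex_regs_below P : exists R, regs_below R P.
Proof.
elim: P => [|i P [R R_ok]]; first by exists 0.
exists (maxn (instr_reg i).+1 R); rewrite /regs_below /= leq_max leqnn /=.
by apply: sub_all R_ok => j lt_j; rewrite leq_max lt_j orbT.
Qed.

Section Diagonal.

Variables (P : program) (body pref : seq nat) (y0 cq : nat).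

Let prelude := compile 0 (encoder_cmd body pref y0 cq).

(* Halts if [P] answers 0 and loops on the last instruction if it answers 1. *)
Definition diagonal : program :=
  prelude ++ map (reloc (size prelude) (size P)) P ++
  let e := size prelude + size P in [:: DEC 0 e.+2; DEC 0 e.+1].

(** The shape of [enc_instance] for a TBox with tail of code [x] and a query of code [cq]; the
    successor comes from [enc_seq]. *)
Definition diagonal_input (x : nat) : nat :=
  cpair (cpair (foldr cpair (iter x (fun y => foldr cpair y body) y0) pref)
               x).+1 cq.

Lemma size_diagonal : size diagonal = (size prelude + size P).+2.
Proof. by rewrite /diagonal !size_cat size_map /=; lia. Qed.

Lemma regs_below_diagonal R :
  8 <= R -> regs_below R P -> regs_below R diagonal.
Proof.
move=> R_ge P_lt; have prelude_lt : regs_below R prelude.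
  by apply: regs_below_compile; [rewrite /zero_reg; lia | apply: regs_below_encoder].
have R_gt0 : 0 < R by lia.
have := P_lt; rewrite -(regs_below_reloc R (size prelude) (size P)) => P'_lt.
rewrite /regs_below all_cat; apply/andP; split; first exact: prelude_lt.
by rewrite all_cat; apply/andP; split; [exact: P'_lt | rewrite /= R_gt0].
Qed.

Lemma init_state_nth x : init_state x = (0, nth 0 [:: x; 0; 0; 0; 0; 0; 0; 0]).
Proof.
congr pair; apply: functional_extensionality.
by do 8!case=> //; move=> k; rewrite /= nth_nil.
Qed.

Lemma diagonal_simulates x y : halts_with P (diagonal_input x) y ->
  exists2 f, f 0 = y & reaches diagonal (init_state x) (size prelude + size P, f).
Proof.
case=> n [le_n ans]; exists (iter n (step P) (init_state (diagonal_input x))).2.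
  by [].
have run1 := compile_exec _ _ _ (exec_encoder body pref y0 cq x) [::].
rewrite init_state_nth.
apply: reaches_trans (run1 _ (avoids_encoder body pref y0 cq) erefl) _.
have sim := reaches_reloc prelude P
  [:: DEC 0 (size prelude + size P).+2; DEC 0 (size prelude + size P).+1]
  (init_state (diagonal_input x)).2 n.
have regs_e : (init_state (diagonal_input x)).2 =
    nth 0 [:: diagonal_input x; 0; 0; 0; 0; 0; 0; 0] by rewrite init_state_nth.
(* As [P] has halted, truncation puts the counter exactly at the end of its copy. *)
rewrite (minn_idPr le_n) {1}regs_e in sim.
by rewrite add0n -(size_compile 0); apply: sim.
Qed.

Let body_size := size prelude + size P.

Lemma step_diagonal0 f :
  step diagonal (body_size, f) =
  if f 0 == 0 then (body_size.+2, f) else (body_size.+1, upd f 0 (f 0).-1).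
Proof.
set pre := prelude ++ map (reloc (size prelude) (size P)) P.
have <- : size pre = body_size by rewrite size_cat size_map.
have -> : diagonal = pre ++ DEC 0 (size pre).+2 :: [:: DEC 0 (size pre).+1].
  by rewrite /pre -catA size_cat size_map.
exact: step_cat.
Qed.

(** After the answer 1 the preceding [DEC] has lowered register 0 to 0, and this last instruction
    jumps to itself. *)
Lemma step_diagonal1 f : f 0 = 0 ->
  step diagonal (body_size.+1, f) = (body_size.+1, f).
Proof.
move=> f0; set pre := rcons (prelude ++ map (reloc (size prelude) (size P)) P)
  (DEC 0 body_size.+2).
have <- : size pre = body_size.+1 by rewrite size_rcons size_cat size_map.
have -> : diagonal = pre ++ [:: DEC 0 (size pre)].
  by rewrite /pre size_rcons cat_rcons -catA size_cat size_map.
by rewrite step_cat f0.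
Qed.

Lemma diagonal_halts x : halts_with P (diagonal_input x) 0 -> halts diagonal x.
Proof.
case/diagonal_simulates => f f0 run.
apply: (reaches_halts _ _ (body_size.+2, f)); last by rewrite size_diagonal.
apply: reaches_trans run _; apply: reaches_step.
by rewrite step_diagonal0 f0; apply: reaches_refl.
Qed.

Lemma diagonal_loops x :
  halts_with P (diagonal_input x) 1 -> ~ halts diagonal x.
Proof.
case/diagonal_simulates => f f0 run.
apply: (reaches_loop _ _ (body_size.+1, upd f 0 0)).
- apply: reaches_trans run _; apply: reaches_step.
  by rewrite step_diagonal0 f0; apply: reaches_refl.
- by rewrite step_diagonal1.
by rewrite size_diagonal.
Qed.

End Diagonal.
(** * The TBox and the query *)

(** The operation leading from the stored to the predicted value of a column. [OInit] is for the
    first block, whose columns have no predecessor; [OZero] and [ODec] are the two outcomes of a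
    [DEC]. *)
Inductive op : Type := OInit | OKeep | OZero | OInc | ODec.

(* The cells [KTop] and [KBot] mark the stored value. The predicted value is
   marked by [KBot] and by [KTop], or by [KPre], the cell above [KTop], for
   [OInc], or by [KSub], the cell below [KTop], for [ODec]. *)
Inductive kind : Type := KHigh | KPre | KTop | KSub | KMid | KBot | KLow.

Definition op_val (o : op) (v : nat) : nat :=
  match o with
  | OInit | OZero => 0 | OKeep => v | OInc => v.+1 | ODec => v.-1
  end.

Definition op_ok (o : op) (v : nat) : bool :=
  match o with OInit | OZero => v == 0 | ODec => 0 < v | _ => true end.

(** Read downwards, a column is a run of [KHigh], then [KTop], a run of [KMid], [KBot], and [KLow]
    forever. [OInc] forces [KPre] before [KTop], [ODec] forces [KSub] after it, and [OInit] and
    [OZero] leave no cell between the marks. *)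
Definition follow (o : op) (k : kind) : seq kind :=
  match k with
  | KHigh => if o is OInc then [:: KHigh; KPre] else [:: KHigh; KTop]
  | KPre => [:: KTop]
  | KTop => match o with
            | OInit | OZero => [:: KBot]
            | ODec => [:: KSub]
            | _ => [:: KMid; KBot]
            end
  | KSub | KMid => [:: KMid; KBot]
  | KBot | KLow => [:: KLow]
  end.

Definition start (o : op) : seq kind :=
  if o is OInit then [:: KTop] else follow o KHigh.

Definition is_cur (k : kind) : bool :=
  match k with KTop | KBot => true | _ => false end.

Definition is_next (o : op) (k : kind) : bool :=
  match k, o with
  | KTop, OInc | KTop, ODec => false
  | KTop, _ | KBot, _ | KPre, _ | KSub, _ => true
  | _, _ => false
  end.

(** Query atoms are positive, so the absence of a mark has a name of its own, [NNotCur]. *)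
Inductive name : Type :=
| NNext | NNotCur | NOp of op | NCell of op & kind | NPc of nat.

Definition op_code (o : op) : nat :=
  match o with OInit => 0 | OKeep => 1 | OZero => 2 | OInc => 3 | ODec => 4 end.

Definition kind_code (k : kind) : nat :=
  match k with
  | KHigh => 0 | KPre => 1 | KTop => 2 | KSub => 3 | KMid => 4 | KBot => 5
  | KLow => 6
  end.

Definition name_code (a : name) : cname :=
  match a with
  | NNext => 0
  | NNotCur => 1
  | NOp o => 2 + op_code o
  | NCell o k => 7 + (7 * op_code o + kind_code k)
  | NPc pc => 42 + pc
  end.

Lemma name_code_inj : injective name_code.
Proof.
have op_lt o : op_code o < 5 by case: o.
have kind_lt k : kind_code k < 7 by case: k.
have op_inj : injective op_code by case; case.
have kind_inj : injective kind_code by case; case.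
case=> [||o|o k|pc]; case=> [||o'|o' k'|pc'] //= eq_ab.
all: try have := op_lt o; try have := kind_lt k.
all: try have := op_lt o'; try have := kind_lt k'; try lia.
- by move=> _ _; rewrite (op_inj o o') //; lia.
- move=> *; have eq_o : op_code o = op_code o' by lia.
  by rewrite (op_inj _ _ eq_o) (kind_inj k k') //; lia.
by congr NPc; lia.
Qed.

Definition named (a : name) : concept := CName (name_code a).

Definition disj (s : seq concept) : concept :=
  CNeg (foldr (fun C D => CAnd (CNeg C) D) CTop s).

Lemma csem_disj I s d :
  csem I (disj s) d <-> exists2 C, List.In C s & csem I C d.
Proof.
elim: s => [|C s IHs]; first by split=> [H|[C []]]; case: H.
split=> [H|[D [<-|s_D] D_d]].
- case: (classic (csem I C d)) => C_d; first by exists C; [left|].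
  have /IHs[D s_D D_d] : csem I (disj s) d by move=> H'; apply: H; split.
  by exists D; [right|].
- by case=> nC_d _; apply: nC_d.
by case=> _; apply/IHs; exists D.
Qed.

Definition block (ops : seq op) (C : concept) : concept :=
  foldr (fun o D => CEx role_r (CAnd (named (NOp o)) D)) C ops.

Definition ops_at (R r : nat) (o : op) : seq op :=
  [seq if i == r then o else OKeep | i <- iota 0 R].

Lemma size_ops_at R r o : size (ops_at R r o) = R.
Proof. by rewrite size_map size_iota. Qed.

Lemma nth_ops_at R r o i : i < R ->
  nth OKeep (ops_at R r o) i = if i == r then o else OKeep.
Proof. by move=> lt_i; rewrite (nth_map 0) ?size_iota // nth_iota. Qed.

Definition all_ops : seq op := [:: OInit; OKeep; OZero; OInc; ODec].

Definition all_cells : seq (op * kind) :=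
  allpairs pair all_ops [:: KHigh; KPre; KTop; KSub; KMid; KBot; KLow].

Definition cell_gci (c : op * kind) : gci :=
  let: (o, k) := c in
  (named (NCell o k),
   CAnd (disj [seq CEx role_s (named (NCell o k')) | k' <- follow o k])
  (CAnd (if is_next o k then named NNext else CTop)
        (if is_cur k then CTop else named NNotCur))).

Definition op_gci (o : op) : gci :=
  (named (NOp o), disj [seq named (NCell o k) | k <- start o]).

(** A counter outside the program means halting and is made unsatisfiable. *)
Definition pc_concept (P : program) (pc : nat) : concept :=
  if pc < size P then named (NPc pc) else CNeg CTop.

(** At a [DEC] the model guesses the outcome of the zero test; the columns then refute a wrong
    guess. *)
Definition instr_gci (R : nat) (P : program) (pc : nat) : gci :=
  (named (NPc pc),
   match nth (INC 0) P pc with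
   | INC r => block (ops_at R r OInc) (pc_concept P pc.+1)
   | DEC r j => disj [:: block (ops_at R r OZero) (pc_concept P j);
                         block (ops_at R r ODec) (pc_concept P pc.+1)]
   end).

Definition program_tbox (R : nat) (P : program) : tbox :=
  map cell_gci all_cells ++ map op_gci all_ops ++
  map (instr_gci R P) (iota 0 (size P)).

Definition role_root : role := 2.

(** With [CTop] on the left, every model contains a start of the run. The separate role [role_root]
    lies outside all languages of the query, so it creates no matches. *)
Definition input_gci (R x : nat) : gci :=
  (CTop, CEx role_root (block (nseq R OInit)
           (iter x (block (ops_at R 0 OInc)) (named (NPc 0))))).

(* Variables: 0 is the common source of the two r^#s^# paths, 1 and 2 are their
   ends, and 3, ..., 3 + R are consecutive nodes of the r-path. *)
Definition clash_query (R : nat) : query :=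
  [:: AConc (name_code NNext) 1; AConc (name_code NNotCur) 2;
      ALang LRnSn 0 1; ALang LRnSn 0 2;
      ALang LRstar 0 3; ALang LSstar 3 1; ALang LSstar (3 + R) 2] ++
  [seq ARole role_r (3 + j) (4 + j) | j <- iota 0 R].

Lemma In_map {A B : Type} (f : A -> B) (s : seq A) (y : B) :
  List.In y (map f s) <-> exists2 x, List.In x s & f x = y.
Proof.
by split=> [/List.in_map_iff[x []]|[x s_x <-]]; [exists x | apply: List.in_map].
Qed.

Lemma In_iota m n i : List.In i (iota m n) <-> m <= i < m + n.
Proof.
elim: n m => [|n IHn] m /=; first by split=> //; lia.
rewrite IHn; split; first by case; lia.
by move=> H; case: (eqVneq m i) => [->|]; [left | right; lia].
Qed.

Lemma In_all_ops o : List.In o all_ops.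
Proof. by case: o => /=; tauto. Qed.

Lemma In_all_cells o k : List.In (o, k) all_cells.
Proof. by case: o; case: k => /=; tauto. Qed.

Lemma sat_tbox_cat I T1 T2 :
  sat_tbox I (T1 ++ T2) <-> sat_tbox I T1 /\ sat_tbox I T2.
Proof.
rewrite /sat_tbox; split=> [H|[H1 H2] g /List.in_app_iff[]]; last 2 first.
- exact: H1.
- exact: H2.
by split=> g g_T; apply: H; apply/List.in_app_iff; [left | right].
Qed.

Lemma sat_tbox_map I {A : Type} (f : A -> gci) (s : seq A) :
  sat_tbox I (map f s) <->
  forall x, List.In x s -> forall d, csem I (f x).1 d -> csem I (f x).2 d.
Proof.
rewrite /sat_tbox; split=> [H x s_x|H g /In_map[x s_x <-]]; last exact: H.
by apply: H; apply/In_map; exists x.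
Qed.

Lemma reach_nseq I p n (u : nat -> dom I) :
  (forall j, j < n -> rI I p (u j) (u j.+1)) -> reach I (nseq n p) (u 0) (u n).
Proof.
elim: n u => [|n IHn] u step_u //=; exists (u 1); split; first exact: step_u.
by apply: (IHn (fun j => u j.+1)) => j lt_j; apply: step_u.
Qed.

Lemma reach_cat I w1 w2 d e f :
  reach I w1 d e -> reach I w2 e f -> reach I (w1 ++ w2) d f.
Proof.
elim: w1 d => [|p w1 IHw] d /=; first by move->.
by case=> d' [dd' d'e] ef; exists d'; split=> //; apply: IHw.
Qed.

(** * Soundness of the simulation *)

(* Lower bound on the rank of every later cell of the column. *)
Definition post_rank (k : kind) : nat :=
  match k with KHigh => 0 | KPre => 2 | KTop | KSub | KMid => 3 | _ => 5 end.

Definition rank (k : kind) : nat :=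
  match k with
  | KHigh => 0 | KPre => 1 | KTop => 2 | KSub | KMid => 3 | KBot => 4 | KLow => 5
  end.

Lemma follow_rank o k k' : List.In k' (follow o k) ->
  post_rank k <= rank k' /\ post_rank k <= post_rank k'.
Proof. by case: o; case: k => /=; intuition subst. Qed.

Definition column (o : op) (L : nat) (ks : nat -> kind) : Prop :=
  List.In (ks 0) (start o) /\
  forall m, m < L -> List.In (ks m.+1) (follow o (ks m)).

Lemma column_rank o L ks m m' : column o L ks -> m < m' -> m' <= L ->
  post_rank (ks m) <= rank (ks m').
Proof.
case=> _ fol lt_m le_L.
suff [] : post_rank (ks m) <= rank (ks m') /\ post_rank (ks m) <= post_rank (ks m').
  by [].
elim: m' lt_m le_L => // m' IHm' lt_m le_L.
have [r1 r2] := follow_rank _ _ _ (fol m' le_L).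
case: (eqVneq m m') => [-> //|ne_m].
have [_ r3] := IHm' ltac:(lia) ltac:(lia); lia.
Qed.

(** At [KTop] and at [KBot] the bound [post_rank] exceeds [rank], so neither recurs. *)
Lemma column_cur o L ks m1 m2 : column o L ks -> m1 < m2 -> m2 <= L ->
  is_cur (ks m1) -> is_cur (ks m2) -> ks m1 = KTop /\ ks m2 = KBot.
Proof.
move=> col lt_m le_L; have := column_rank _ _ _ _ _ col lt_m le_L.
by case: (ks m1) => //; case: (ks m2).
Qed.

(** The stored marks are [KTop] and [KBot] at distance [v + 1]; the transitions around [KTop] then
    fix the upper predicted mark. *)
Lemma column_next o L ks m1 v : column o L ks -> o <> OInit -> 0 < m1 ->
  m1 + v < L -> is_cur (ks m1) -> is_cur (ks (m1 + v).+1) ->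
  op_ok o v /\ exists m1', [/\ m1' + (op_val o v) = m1 + v, is_next o (ks m1')
                            & is_next o (ks (m1 + v).+1)].
Proof.
move=> col o_run m1_gt0 le_L cur1 cur2.
have [top1 bot2] := column_cur _ _ _ m1 (m1 + v).+1 col ltac:(lia) le_L cur1 cur2.
have next2 : is_next o (ks (m1 + v).+1) by rewrite bot2; case: (o).
have next1 : List.In (ks m1.+1) (follow o KTop).
  by rewrite -top1; apply: (proj2 col); lia.
have later : 0 < v -> post_rank (ks m1.+1) <= rank KBot.
  by move=> v_gt0; rewrite -bot2; apply: (column_rank _ _ _ _ _ col); lia.
have v0 : v = 0 -> ks m1.+1 = KBot by move=> v0; rewrite -bot2 v0 addn0.
case: o => [||||] in col o_run next1 next2 *.
- by case: o_run.
- by split=> //; exists m1; rewrite /= top1.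
- split; last exists m1; rewrite /= ?top1.
    by case: next1 later => // <- /=; case: (v) => // v' /(_ isT).
  split=> //; case: next1 later => // <- /=; case: (v) => // v' /(_ isT) //.
(* For [OInc] only [KPre] leads to [KTop], and [0 < m1] leaves room for it. *)
- split=> //; exists m1.-1; split=> //=; first lia.
  have := proj2 col m1.-1 ltac:(lia); rewrite prednK // top1.
  by case: (ks _) => /=; intuition.
(* [KSub] right below [KTop] excludes [v = 0], where [KBot] would take its place. *)
- case: next1 => // sub1.
  have v_gt0 : 0 < v by case: (posnP v) => // /v0; rewrite -sub1.
  by split=> //; exists m1.+1; rewrite -sub1 /=; split=> //; lia.
Qed.

Section HaltingEntails.

Variables (R : nat) (P : program) (I : interp).
Hypotheses (R_gt0 : 0 < R) (P_regs : regs_below R P).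
Hypotheses (sat_P : sat_tbox I (program_tbox R P)).
Hypothesis no_clash : ~ sat_query I (clash_query R).

Let sat_cell o k d : csem I (named (NCell o k)) d ->
  [/\ exists2 k', List.In k' (follow o k) &
        exists2 e, rI I role_s d e & csem I (named (NCell o k')) e,
      is_next o k -> csem I (named NNext) d &
      ~~ is_cur k -> csem I (named NNotCur) d].
Proof.
move=> cell_d; case/sat_tbox_cat: sat_P => /sat_tbox_map sat_cells _.
have [] := sat_cells _ (In_all_cells o k) d cell_d.
case/csem_disj=> C /In_map[k' k'_in <-] [e [de cell_e]] [next cur].
split; first by exists k' => //; exists e.
  by move=> is_n; rewrite is_n in next.
by move=> /negPf not_c; rewrite not_c in cur.
Qed.

Let sat_op o d : csem I (named (NOp o)) d ->
  exists2 k, List.In k (start o) & csem I (named (NCell o k)) d.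
Proof.
move=> op_d; case/sat_tbox_cat: sat_P => _ /sat_tbox_cat[/sat_tbox_map sat_ops _].
have /csem_disj[C /In_map[k k_in <-] cell_d] := sat_ops _ (In_all_ops o) d op_d.
by exists k.
Qed.

Let sat_instr pc d : pc < size P -> csem I (named (NPc pc)) d ->
  csem I (instr_gci R P pc).2 d.
Proof.
move=> lt_pc; case/sat_tbox_cat: sat_P => _ /sat_tbox_cat[_ /sat_tbox_map sat_i].
by apply: sat_i; apply/In_iota.
Qed.

Definition s_column (o : op) (L : nat) (u : nat -> dom I) (ks : nat -> kind) :=
  [/\ column o L ks, forall m, m < L -> rI I role_s (u m) (u m.+1) &
      forall m, m <= L -> csem I (named (NCell o (ks m))) (u m)].

(** Columns are unfolded to a finite length by induction, which avoids any choice principle. *)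
Lemma s_column_exists o L d : csem I (named (NOp o)) d ->
  exists u ks, s_column o L u ks /\ u 0 = d.
Proof.
have cells k e : csem I (named (NCell o k)) e -> exists u ks,
    [/\ u 0 = e, ks 0 = k,
        forall m, m < L -> List.In (ks m.+1) (follow o (ks m)),
        forall m, m < L -> rI I role_s (u m) (u m.+1)
      & forall m, m <= L -> csem I (named (NCell o (ks m))) (u m)].
  elim: L k e => [|L IHL] k e cell_e.
    by exists (fun=> e), (fun=> k); split=> // m.
  have [[k' k'_in [e' ee' cell_e']] _ _] := sat_cell _ _ _ cell_e.
  have [u [ks [u0 ks0 fol step_u cell_u]]] := IHL _ _ cell_e'.
  exists (fun m => if m is m'.+1 then u m' else e),
         (fun m => if m is m'.+1 then ks m' else k).
  split=> // -[|m] //; rewrite ?ltnS ?u0 ?ks0 => // lt_m.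
  - exact: fol.
  - exact: step_u.
  exact: cell_u.
case/sat_op=> k k_start /cells[u [ks [u0 ks0 fol step_u cell_u]]].
by exists u, ks; split=> //; split=> //; split; rewrite // ks0.
Qed.

Definition r_walk (n : nat) (x : nat -> dom I) : Prop :=
  forall j, j < n -> rI I role_r (x j) (x j.+1).

(** Depth [m] in column [n] and depth [m + R] in column [n + R] have equal height, so a missing mark
    would give a match of the query. *)
Lemma next_is_cur n x o u ks o' u' ks' m :
  r_walk (n + R) x -> s_column o n u ks -> s_column o' (n + R) u' ks' ->
  u 0 = x n -> u' 0 = x (n + R) -> m <= n -> is_next o (ks m) ->
  is_cur (ks' (m + R)).
Proof.
move=> walk [_ step_u cell_u] [_ step_u' cell_u'] u0 u'0 le_m nextm.
apply/negPn/negP => not_cur; apply: no_clash.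
have rsn N (w : nat -> dom I) l : N <= n + R -> l <= N ->
    w 0 = x N -> (forall i, i < l -> rI I role_s (w i) (w i.+1)) ->
    exists w', in_lang LRnSn w' /\ reach I w' (x (N - l)) (w l).
  move=> le_N le_l w0 step_w; exists (nseq l role_r ++ nseq l role_s).
  split; first by exists l.
  apply: (reach_cat _ _ _ _ (x N)); last by rewrite -w0; apply: reach_nseq.
  rewrite -[X in reach _ _ _ (x X)](subnK le_l).
  have := reach_nseq I role_r l (fun j => x (N - l + j)); rewrite /= addn0.
  by apply=> j lt_j; rewrite addnS; apply: walk; lia.
exists (fun v => match v with
                 | 0 => x (n - m) | 1 => u m | 2 => u' (m + R)
                 | v'.+3 => x (n + v') end).
move=> a [<-|[<-|[<-|[<-|[<-|[<-|[<-|]]]]]]] //=.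
- by have [_ /(_ nextm)] := sat_cell _ _ _ (cell_u m le_m).
- by have [_ _ /(_ not_cur)] := sat_cell _ _ _ (cell_u' (m + R) ltac:(lia)).
- by apply: rsn => // [|i lt_i]; [lia | apply: step_u; lia].
(* Both paths start at the same node, since [n + R - (m + R) = n - m]. *)
- rewrite -(subnDr R) //; apply: rsn => // [|i lt_i]; first lia.
  by apply: step_u'; lia.
- exists (nseq m role_r); split; first by exists m.
  rewrite addn0 -[X in reach _ _ _ (x X)](subnK le_m).
  have := reach_nseq I role_r m (fun j => x (n - m + j)); rewrite /= addn0.
  by apply=> j lt_j; rewrite addnS; apply: walk; lia.
- exists (nseq m role_s); split; first by exists m.
  by rewrite addn0 -u0; apply: reach_nseq => i lt_i; apply: step_u; lia.
- exists (nseq (m + R) role_s); split; first by exists (m + R).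
  by rewrite -u'0; apply: reach_nseq => i lt_i; apply: step_u'; lia.
case/In_map=> j /In_iota lt_j <- /=.
by rewrite addnS; apply: walk; lia.
Qed.

(** The value is the predicted one. The bound [m + v < n] keeps the lower mark at depth at most [n],
    so that the source of its path lies on the walk. *)
Definition stores (n : nat) (d : dom I) (v : nat) : Prop :=
  exists o u ks m, [/\ s_column o n u ks, u 0 = d, m + v < n,
                       is_next o (ks m) & is_next o (ks (m + v).+1)].

Lemma stores_init n d : 0 < n -> csem I (named (NOp OInit)) d -> stores n d 0.
Proof.
move=> n_gt0 /(s_column_exists OInit n)[u [ks [col u0]]].
exists OInit, u, ks, 0; case: (col) => -[[top0|[]] fol] _ _.
split=> //; rewrite -?top0 // addn0.
by have := fol 0 n_gt0; rewrite -top0 /= => -[<-|[]].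
Qed.

Lemma stores_step n x v o : r_walk (n + R) x -> stores n (x n) v ->
  o <> OInit -> csem I (named (NOp o)) (x (n + R)) ->
  op_ok o v /\ stores (n + R) (x (n + R)) (op_val o v).
Proof.
move=> walk [o' [u [ks [m [col u0 lt_n next1 next2]]]]] o_run.
case/(s_column_exists o (n + R)) => u' [ks' [col' u'0]].
have cur1 := next_is_cur _ _ _ _ _ _ _ _ m walk col col' u0 u'0 ltac:(lia) next1.
have := next_is_cur _ _ _ _ _ _ _ _ (m + v).+1 walk col col' u0 u'0 ltac:(lia) next2.
rewrite addSn addnAC => cur2; have [kcol _ _] := col'.
have [o_ok [m' [eq_m' n1 n2]]] :=
  column_next _ _ _ (m + R) v kcol o_run ltac:(lia) ltac:(lia) cur1 cur2.
split=> //; exists o, u', ks', m'; rewrite eq_m'; split=> //; lia.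
Qed.

(** * Machine configurations along an r-walk *)

Lemma block_walk ops C N x : r_walk N x -> csem I (block ops C) (x N) ->
  exists y, [/\ forall j, j <= N -> y j = x j, r_walk (N + size ops) y,
    forall i, i < size ops ->
      csem I (named (NOp (nth OKeep ops i))) (y (N + i).+1)
    & csem I C (y (N + size ops))].
Proof.
elim: ops N x => [|o ops IHops] N x walk /=.
  by rewrite addn0 => C_x; exists x.
case=> d [xd [op_d D_d]]; pose x' j := if j <= N then x j else d.
have x'S : x' N.+1 = d by rewrite /x' ltnn.
have walk' : r_walk N.+1 x'.
  move=> j; rewrite ltnS leq_eqVlt => /orP[/eqP->|lt_j].
    by rewrite x'S /x' leqnn.
  by rewrite /x' lt_j ltnW //; apply: walk.
rewrite -x'S in D_d; have [y [eq_y walk_y ops_y C_y]] := IHops _ _ walk' D_d.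
exists y; rewrite addnS -addSn; split=> //.
- by move=> j le_j; rewrite eq_y /x' ?le_j // ltnW.
case=> [_|i]; first by rewrite addn0 eq_y // x'S.
by rewrite ltnS addnS => /ops_y.
Qed.

Definition config (n : nat) (x : nat -> dom I) (f : nat -> nat) : Prop :=
  r_walk (n + R) x /\ forall i, i < R -> stores (n + i).+1 (x (n + i).+1) (f i).

Lemma config_block n x f ops C : config n x f -> size ops = R ->
  (forall i, i < R -> nth OKeep ops i <> OInit) ->
  csem I (block ops C) (x (n + R)) ->
  (forall i, i < R -> op_ok (nth OKeep ops i) (f i)) /\
  exists n' y, config n' y (fun i => op_val (nth OKeep ops i) (f i)) /\
    csem I C (y (n' + R)).
Proof.
move=> [walk st] size_ops run_ops /(block_walk _ _ _ _ walk).
rewrite size_ops => -[y [eq_y walk_y ops_y C_y]].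
have st_y i : i < R -> op_ok (nth OKeep ops i) (f i) /\
    stores ((n + i).+1 + R) (y ((n + i).+1 + R)) (op_val (nth OKeep ops i) (f i)).
  move=> lt_i; apply: stores_step; last 2 first.
  - exact: run_ops.
  - by have := ops_y i lt_i; congr (csem I _ (y _)); lia.
  - by move=> j lt_j; apply: walk_y; lia.
  by rewrite eq_y; [apply: st | lia].
split=> [i /st_y[] //|]; exists (n + R), y; split=> //; split=> // i lt_i.
by rewrite addnAC -addSn; case: (st_y i lt_i).
Qed.

Lemma config_ops_at n x f r o C : config n x f -> r < R -> o <> OInit ->
  csem I (block (ops_at R r o) C) (x (n + R)) ->
  op_ok o (f r) /\
  exists n' y, config n' y (upd f r (op_val o (f r))) /\ csem I C (y (n' + R)).
Proof.
move=> conf lt_r o_run sem_C.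
have [||ok_f [n' [y [[walk st] C_y]]]] := config_block _ _ _ _ _ conf _ _ sem_C.
- exact: size_ops_at.
- by move=> i lt_i; rewrite nth_ops_at //; case: eqP.
split; first by have := ok_f r lt_r; rewrite nth_ops_at // eqxx.
exists n', y; split=> //; split=> // i lt_i; have := st i lt_i.
by rewrite nth_ops_at // /upd; case: eqP => [->|].
Qed.

Lemma config_step n x pc f : config n x f -> pc < size P ->
  csem I (named (NPc pc)) (x (n + R)) ->
  exists n' y, config n' y (step P (pc, f)).2 /\
    csem I (pc_concept P (step P (pc, f)).1) (y (n' + R)).
Proof.
move=> conf lt_pc /(sat_instr _ _ lt_pc).
have := all_nthP (INC 0) P_regs pc lt_pc; rewrite /step lt_pc.
rewrite /instr_gci; case: nth => [r|r j] lt_r; cbn iota beta delta [fst snd].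
  by case/(config_ops_at _ _ _ _ _ _ conf lt_r).
case/csem_disj=> C [<-|[<-|[]]] sem_C.
  have [//|/= f_r [n' [y [[walk st] C_y]]]] :=
    config_ops_at _ _ _ _ _ _ conf lt_r _ sem_C.
  rewrite f_r; exists n', y; split=> //; split=> // i lt_i.
  (* [OZero] writes 0 into register [r], which changes nothing because [f r = 0]. *)
  by have := st i lt_i; rewrite /upd; case: eqP => // -> /=; rewrite (eqP f_r).
have [//|/= f_r] := config_ops_at _ _ _ _ _ _ conf lt_r _ sem_C.
by rewrite (gtn_eqF f_r).
Qed.

(** The walk follows the run step by step, and a halting counter would yield an instance of
    [CNeg CTop]. The program must be nonempty because [NPc 0] is asserted without a range check. *)
Lemma input_not_halting x d : 0 < size P ->
  csem I (input_gci R x).2 d -> ~ halts P x.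
Proof.
move=> P_gt0 [e [_ sem_e]] [n]; set C := named (NPc 0) in sem_e.
pose regs w := (init_state w).2.
have [|y [_ walk_y ops_y C_y]] := block_walk _ _ 0 (fun=> e) _ sem_e.
  by [].
rewrite size_nseq in walk_y ops_y C_y.
have load_x z w k y' : config k y' (regs w) ->
    csem I (iter z (block (ops_at R 0 OInc)) C) (y' (k + R)) ->
    exists k' y'', config k' y'' (regs (w + z)) /\ csem I C (y'' (k' + R)).
  elim: z w k y' => [|z IHz] w k y' conf sem_C.
    by rewrite addn0; exists k, y'.
  have [//|_ [k' [y'' [conf' sem_C']]]] :=
    config_ops_at _ _ _ _ _ _ conf R_gt0 _ sem_C.
  rewrite -addSnnS; apply: IHz sem_C'; case: conf' => walk' st'.
  split=> // i lt_i; have := st' i lt_i; rewrite /upd /regs /=.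
  by case: eqP.
have run m : exists k y', [/\ config k y' (iter m (step P) (init_state x)).2,
    (iter m (step P) (init_state x)).1 < size P &
    csem I (named (NPc (iter m (step P) (init_state x)).1)) (y' (k + R))].
  elim: m => [|m [k [y' [conf lt_pc sem_pc]]]].
    have [|k [y' [conf sem_C']]] := load_x x 0 0 y _ C_y; last by exists k, y'.
    split=> // i lt_i; rewrite (_ : regs 0 i = 0); last by rewrite /regs /=; case: eqP.
    apply: stores_init => //; have := ops_y i lt_i.
    by rewrite nth_nseq lt_i.
  rewrite iterS; case: (iter m (step P) (init_state x)) conf lt_pc sem_pc => pc f.
  move=> conf lt_pc sem_pc.
  have [k' [y'' [conf' sem_C']]] := config_step _ _ _ _ conf lt_pc sem_pc.
  move: sem_C'; rewrite /pc_concept; case: ifP => lt_pc' sem_C'; last by case: sem_C'.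
  by exists k', y''.
by have [k [y' [_ lt_n _]]] := run n; rewrite leqNgt lt_n.
Qed.

End HaltingEntails.

(** * The countermodel of an infinite run *)

(* The column with cells [KTop] and [KBot] at depths [a] and [a + v + 1]. *)
Definition kind_at (o : op) (a v m : nat) : kind :=
  if m < a then (if o is OInc then if m.+1 == a then KPre else KHigh else KHigh)
  else if m == a then KTop
  else if m <= a + v then
    (if o is ODec then if m == a.+1 then KSub else KMid else KMid)
  else if m == (a + v).+1 then KBot else KLow.

(** [op_ok] rules out cells between the marks under [OInit] and [OZero], and their absence under
    [ODec]. *)
Lemma kind_at_follow o a v m : op_ok o v ->
  List.In (kind_at o a v m.+1) (follow o (kind_at o a v m)).
Proof.
rewrite /kind_at; case: (ltngtP m a) => [lt_ma|gt_ma|->].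
- case: (ltngtP m.+1 a) => [lt_m|gt_m|eq_m]; first 2 last.
  + by case: o => /=; tauto.
  + by case: o => /=; try tauto; case: (m.+2 == a) => /=; tauto.
  lia.
- have -> : (m.+1 < a) = false by lia.
  have -> : (m.+1 == a) = false by lia.
  rewrite eqSS (gtn_eqF gt_ma).
  case: (leqP m (a + v)) => [le_m|gt_m].
    rewrite ltn_neqAle le_m andbT eqSS; case: eqP => [eq_m|ne_m] ok_v.
      by case: o ok_v => //=; try tauto; case: ifP => /=; tauto.
    by case: o ok_v => //=; try tauto; case: ifP => /=; tauto.
  have -> : (m < a + v) = false by lia.
  rewrite eqSS (gtn_eqF gt_m); case: eqP => _ /=; tauto.
have -> : (a.+1 < a) = false by lia.
have -> : (a.+1 == a) = false by lia.
rewrite -addn1 leq_add2l addn1 eqSS eqxx.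
case: v => [|v] /=; first by rewrite addn0 eqxx; case: o => //=; tauto.
by case: o => //=; tauto.
Qed.

Lemma kind_at_start o a v : (o = OInit -> a = 0) -> (o = OInc -> 0 < a) ->
  List.In (kind_at o a v 0) (start o).
Proof.
case: a => [|a]; case: o => init inc; try (by have := init erefl);
  try (by have := inc erefl); rewrite /kind_at /=; try tauto.
by case: eqP => _ /=; tauto.
Qed.

Lemma is_cur_kind_at o a v m : m = a \/ m = (a + v).+1 -> is_cur (kind_at o a v m).
Proof.
rewrite /kind_at; case=> ->; first by rewrite ltnn eqxx.
have -> : ((a + v).+1 < a) = false by lia.
have -> : ((a + v).+1 == a) = false by lia.
by rewrite ltnn eqxx.
Qed.

Lemma is_next_kind_at o a v m : op_ok o v -> is_next o (kind_at o a v m) ->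
  m + op_val o v = a + v \/ m = (a + v).+1.
Proof.
rewrite /kind_at; case: ltngtP => [lt_m|gt_m|->].
- by case: o => //= _; case: eqP => // <- _; left; lia.
- case: (leqP m (a + v)) => [le_m|gt_mv].
    by case: o => //= v_gt0; case: eqP => // -> _; left; lia.
  by case: eqP => [-> _ _|//]; right.
by case: o => //= ok_v _; left; lia.
Qed.

Section LoopingCountermodel.

Variables (R : nat) (P : program) (x : nat).
Hypotheses (R_gt0 : 0 < R) (no_halt : ~ halts P x).

Let conf (t : nat) : mstate := iter t (step P) (init_state x).

Let pc_lt t : (conf t).1 < size P.
Proof. by rewrite ltnNge; apply/negP => le_t; apply: no_halt; exists t. Qed.

Definition step_ops (st : mstate) : seq op :=
  match nth (INC 0) P st.1 with
  | INC r => ops_at R r OInc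
  | DEC r _ => ops_at R r (if st.2 r == 0 then OZero else ODec)
  end.

(* Block 0 creates the columns, blocks 1 to [x] load [x] into register 0, and
   block [x + 1 + t] performs step [t]. *)
Definition block_ops (b : nat) : seq op :=
  if b is b'.+1 then
    if b <= x then ops_at R 0 OInc else step_ops (conf (b' - x))
  else nseq R OInit.

(** Values on entry to block [b]. Blocks 0 and 1 both start from zeros, as [b.-1] truncates; block
    [x + 1 + t] starts from [conf t]. *)
Definition block_regs (b i : nat) : nat :=
  if b <= x then (init_state b.-1).2 i else (conf (b.-1 - x)).2 i.

Lemma block_step b i : i < R ->
  op_ok (nth OKeep (block_ops b) i) (block_regs b i) /\
  block_regs b.+1 i = op_val (nth OKeep (block_ops b) i) (block_regs b i).
Proof.
move=> lt_i; case: b => [|b] /=.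
  rewrite nth_nseq lt_i /block_regs leq0n /=; split; first by case: ifP.
  case: ifP => [_|/negbT]; first by case: eqP.
  by rewrite -leqNgt leqn0 => /eqP x0; rewrite /conf /= x0; case: eqP.
rewrite {1 3}/block_regs; case: ifP => [lt_b|ge_b].
  rewrite nth_ops_at //; case: ifP => [/eqP->|ne_i]; last first.
    split=> //=; rewrite /block_regs /=; case: ifP => _; rewrite ?ne_i //.
    rewrite (_ : b.+1 - x = 0); last by lia.
    by rewrite /= ne_i.
  split=> //=; rewrite /block_regs /=; case: ifP => // ge_b.
  by rewrite (_ : b.+1 - x = 0) /=; lia.
rewrite /block_regs /= (_ : (b.+1 < x) = false); last by lia.
rewrite subSn; last by lia.
rewrite [conf _.+1]/=; have := pc_lt (b - x); rewrite /step_ops.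
case: (conf (b - x)) => pc f /=.
case: (nth (INC 0) P pc) => [r|r j] -> /=; rewrite nth_ops_at // /upd.
  by case: eqP => [->|].
by case: (posnP (f r)) => [f0|f_gt0] /=; case: eqP => [->|]; rewrite ?f0 // f_gt0.
Qed.

(** Each block after block 0 adds at most 1, so the columns are always deep enough for the upper
    mark. *)
Lemma block_regs_le b i : i < R -> block_regs b i <= b.-1.
Proof.
move=> lt_i; elim: b => [|b IHb]; first by rewrite /block_regs /=; case: eqP.
have [_ ->] := block_step b i lt_i; case: b IHb => [|b] IHb.
  by rewrite /= nth_nseq lt_i.
by move: IHb; case: nth => /=; lia.
Qed.

Definition branch_op (n : nat) : op := nth OKeep (block_ops (n.-1 %/ R)) (n.-1 %% R).

Definition branch_val (n : nat) : nat := block_regs (n.-1 %/ R) (n.-1 %% R).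

(** In block [b] the cell [KBot] has depth [b * R + 1], hence the same height in all columns of one
    register, and the height of [KTop] encodes the value. By [branch_val_mul] the subtraction is
    exact. *)
Definition branch_kind (n m : nat) : kind :=
  kind_at (branch_op n) (n.-1 %/ R * R - branch_val n) (branch_val n) m.

Let mod_lt n : n %% R < R. Proof. by rewrite ltn_pmod. Qed.

Lemma branch_val_le n : branch_val n <= (n.-1 %/ R).-1.
Proof. exact: block_regs_le. Qed.

Lemma branch_val_mul n : branch_val n <= n.-1 %/ R * R.
Proof.
apply: leq_trans (branch_val_le n) _; apply: leq_trans (leq_pred _) _.
by rewrite leq_pmulr.
Qed.

Lemma block_op_run b i : i < R -> nth OKeep (block_ops b.+1) i <> OInit.
Proof.
move=> lt_i /=; rewrite /step_ops; case: ifP => _.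
  by rewrite nth_ops_at //; case: ifP.
case: (nth (INC 0) P _) => [r|r j]; rewrite nth_ops_at //; case: ifP => // _.
by case: ifP.
Qed.

Lemma branch_start n : List.In (branch_kind n 0) (start (branch_op n)).
Proof.
apply: kind_at_start.
  rewrite /branch_op; case: (_ %/ _) => // b op_init.
  by case: (block_op_run b _ (mod_lt n.-1)).
have := branch_val_le n; rewrite /branch_op; case: (_ %/ _) => [|b] /=.
  by rewrite nth_nseq mod_lt.
by move=> le_v _; rewrite subn_gt0; nia.
Qed.

Lemma branch_follow n m :
  List.In (branch_kind n m.+1) (follow (branch_op n) (branch_kind n m)).
Proof. by apply: kind_at_follow; case: (block_step (n.-1 %/ R) _ (mod_lt n.-1)). Qed.

Lemma branch_next_cur n m : 0 < n ->
  is_next (branch_op n) (branch_kind n m) -> is_cur (branch_kind (n + R) (m + R)).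
Proof.
move=> n_gt0 nextm.
have [ok_v val'] := block_step (n.-1 %/ R) _ (mod_lt n.-1).
have pred_nR : (n + R).-1 = n.-1 + R by lia.
have div_nR : (n + R).-1 %/ R = (n.-1 %/ R).+1.
  by rewrite pred_nR divnDr ?dvdnn // divnn R_gt0 addn1.
have mod_nR : (n + R).-1 %% R = n.-1 %% R by rewrite pred_nR modnDr.
have val_nR : branch_val (n + R) = op_val (branch_op n) (branch_val n).
  by rewrite /branch_val div_nR mod_nR val'.
have := branch_val_mul n; have := branch_val_le (n + R).
have [] := is_next_kind_at _ _ _ _ ok_v nextm.
  rewrite -/(branch_val n) -/(branch_op n) -val_nR div_nR /= => eq_m le1 le2.
  by apply: is_cur_kind_at; left; rewrite div_nR mulSn; nia.
rewrite -/(branch_val n) div_nR /= => -> le1 le2.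
by apply: is_cur_kind_at; right; rewrite div_nR mulSn; nia.
Qed.

(** The pair [(n, m)] is the cell at depth [m] of column [n]. Column 0 is the unlabelled start, and
    the counter of [conf t] sits on the last column before the block of step [t]. *)
Definition holds (c : name) (d : nat * nat) : Prop :=
  let: (n, m) := d in
  0 < n /\
  match c with
  | NNext => is_next (branch_op n) (branch_kind n m)
  | NNotCur => ~~ is_cur (branch_kind n m)
  | NOp o => m = 0 /\ branch_op n = o
  | NCell o k => branch_op n = o /\ branch_kind n m = k
  | NPc pc => m = 0 /\ exists t, n = (x + t).+1 * R /\ pc = (conf t).1
  end.

Definition countermodel : interp :=
  Interp (nat * nat) (inhabits (0, 0))
    (fun a d => exists c, name_code c = a /\ holds c d)
    (fun p d e =>
       [\/ [/\ p = role_r, d.2 = 0 & e = (d.1.+1, 0)],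
           p = role_s /\ e = (d.1, d.2.+1) | p = role_root /\ e = (0, 0)]).

Lemma csem_named c d : csem countermodel (named c) d <-> holds c d.
Proof. by split=> [[c' [/name_code_inj->]]|h]; last exists c. Qed.

Lemma csem_block ops C N :
  (forall i, i < size ops -> branch_op (N + i).+1 = nth OKeep ops i) ->
  csem countermodel C (N + size ops, 0) ->
  csem countermodel (block ops C) (N, 0).
Proof.
elim: ops N => [|o ops IHops] N ops_N; first by rewrite addn0.
rewrite [size _]/= addnS -addSn => C_end /=; exists (N.+1, 0); split.
  by constructor 1.
split.
  apply: (proj2 (csem_named (NOp o) (N.+1, 0))); do 2!split=> //.
  by have := ops_N 0 isT; rewrite addn0.
apply: IHops => // i lt_i; rewrite addSnnS; exact: (ops_N i.+1).
Qed.

Lemma csem_block_ops b C : csem countermodel C (b.+1 * R, 0) ->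
  csem countermodel (block (block_ops b) C) (b * R, 0).
Proof.
have size_ops : size (block_ops b) = R.
  case: b => [|b] /=; first exact: size_nseq.
  rewrite /step_ops; case: ifP => _; first exact: size_ops_at.
  by case: (nth _ _ _) => *; apply: size_ops_at.
move=> C_end; apply: csem_block; rewrite size_ops; last by rewrite addnC -mulSn.
move=> i lt_i; rewrite /branch_op /= divnMDl // divn_small // addn0.
by rewrite modnMDl modn_small.
Qed.

Lemma csem_pc_concept t :
  csem countermodel (pc_concept P (conf t).1) ((x + t).+1 * R, 0).
Proof.
rewrite /pc_concept pc_lt; apply/csem_named; split; first by rewrite muln_gt0.
by split=> //; exists t.
Qed.

Lemma countermodel_program : sat_tbox countermodel (program_tbox R P).
Proof.
apply/sat_tbox_cat; split; last (apply/sat_tbox_cat; split);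
  apply/sat_tbox_map.
- move=> [o k] _ [n m] /csem_named[n_gt0 [op_n kind_n]]; split; last split.
  + apply/csem_disj; exists (CEx role_s (named (NCell o (branch_kind n m.+1)))).
      apply/In_map; exists (branch_kind n m.+1) => //.
      by rewrite -op_n -kind_n; apply: branch_follow.
    exists (n, m.+1); split; first by constructor 2.
    by apply/csem_named; split.
  + case: ifP => // next_k; apply/csem_named; split=> //.
    by rewrite op_n kind_n.
  case: ifP => // cur_k; apply/csem_named; split=> //.
  by rewrite kind_n cur_k.
- move=> o _ [n m] /csem_named[n_gt0 [-> op_n]]; apply/csem_disj.
  exists (named (NCell o (branch_kind n 0))).
    apply/In_map; exists (branch_kind n 0) => //.
    by rewrite -op_n; apply: branch_start.
  by apply/csem_named; split.
move=> pc _ [n m] /csem_named[_ [-> [t [-> ->]]]].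
(* Block [(x + t).+1] starts at this node and performs step [t]. *)
have := csem_block_ops (x + t).+1; rewrite /block_ops /step_ops.
have -> : ((x + t).+1 <= x) = false by lia.
rewrite addKn; have := csem_pc_concept t.+1; rewrite addnS [conf t.+1]/=.
have := pc_lt t; rewrite /instr_gci; case: (conf t) => pc' f lt_pc.
rewrite /step; cbn iota beta delta [fst snd] in lt_pc |- *; rewrite lt_pc.
case: nth => [r|r j] sem_pc blk; first exact: blk.
case: ifP sem_pc blk => f_r sem_pc blk; apply/csem_disj.
  by exists (block (ops_at R r OZero) (pc_concept P j)); [left | apply: blk].
exists (block (ops_at R r ODec) (pc_concept P pc'.+1)); last exact: blk.
by right; left.
Qed.

Lemma countermodel_input d : csem countermodel (input_gci R x).2 d.
Proof.
exists (0, 0); split; first by constructor 3.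
apply: (csem_block_ops 0); rewrite mul1n.
(* The induction runs backwards: [j] is the number of increments still to come. *)
suff load j : j <= x -> csem countermodel
    (iter j (block (ops_at R 0 OInc)) (named (NPc 0))) ((x - j).+1 * R, 0).
  by have := load x (leqnn x); rewrite subnn mul1n.
elim: j => [|j IHj] le_j.
  apply/csem_named; rewrite subn0; split; first by rewrite muln_gt0.
  by split=> //; exists 0; rewrite addn0.
have := csem_block_ops (x - j.+1).+1; rewrite /block_ops.
have -> : ((x - j.+1).+1 <= x) by lia.
by apply; rewrite -subSn // subSS; apply: IHj; lia.
Qed.

(** * Absence of matches in the countermodel *)

Lemma reach_s l d e : reach countermodel (nseq l role_s) d e ->
  e = (d.1, d.2 + l).
Proof.
elim: l d => [|l IHl] d /=; first by move<-; rewrite addn0; case: d.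
by case=> d' [[[//]|[_ ->]|[//]] /IHl->]; rewrite addnS -addSn.
Qed.

Lemma reach_r l d e : reach countermodel (nseq l role_r) d e ->
  l = 0 /\ e = d \/ d.2 = 0 /\ e = (d.1 + l, 0).
Proof.
elim: l d => [|l IHl] d /=; first by move<-; left.
case=> d' [[[_ d0 ->]|[//]|[//]] /IHl[[-> ->]|[_ ->]]]; right.
  by rewrite addn1.
by rewrite addSnnS.
Qed.

Lemma reach_catV I w1 w2 d f : reach I (w1 ++ w2) d f ->
  exists2 e, reach I w1 d e & reach I w2 e f.
Proof.
elim: w1 d => [|p w1 IHw] d /=; first by exists d.
by case=> d' [dd' /IHw[e d'e ef]]; exists e => //; exists d'.
Qed.

Lemma countermodel_no_clash : ~ sat_query countermodel (clash_query R).
Proof.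
case=> eta sat; have r_edge j : j < R ->
    (eta (3 + j)).2 = 0 /\ eta (4 + j) = ((eta (3 + j)).1.+1, 0).
  move=> lt_j; have edge : List.In (ARole role_r (3 + j) (4 + j)) (clash_query R).
    by do 7!right; apply/In_map; exists j => //; apply/In_iota.
  by case: (sat _ edge) => [[_ d0 eq_e]|[//]|[//]]; split.
have r_path j : j <= R -> eta (3 + j) = ((eta 3).1 + j, 0).
  elim: j => [|j IHj] le_j.
    have [d0 _] := r_edge 0 R_gt0; rewrite !addn0 in d0 *.
    by case: (eta 3) d0 => n m /= ->.
  have [_ eq_e] := r_edge j le_j.
  by rewrite addnS -addSn eq_e IHj ?(ltnW le_j) //= addnS.
have z0 := r_path 0 (leq0n R); have zR := r_path R (leqnn R).
rewrite addn0 addn0 in z0; move: (eta 3).1 => n in z0 zR.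
have get a : List.In a (clash_query R) -> atom_holds countermodel eta a.
  exact: sat.
have [w [[l4 ->] /reach_r x_r]] := get (ALang LRstar 0 3) ltac:(simpl; tauto).
have [k x_k] : exists k, eta 0 = (k, 0).
  by move: x_r; rewrite z0; case: (eta 0) => k c /= [[_ [_ <-]]|[-> _]]; exists k.
(* A path r^l s^l from [(k, 0)] ends at [(k + l, l)], so the column of its end determines the
   depth. *)
have src N y : eta 0 = (k, 0) -> forall w, in_lang LRnSn w ->
    reach countermodel w (eta 0) y -> y.1 = N -> y = (N, N - k) /\ k <= N.
  move=> -> _ [l ->] /reach_catV[e /reach_r e_r /reach_s ->].
  by case: e_r => [[-> ->]|[_ ->]] /= <-; split; rewrite ?addn0 ?subnn //;
    [congr pair; lia | lia].
have [w1 [in1 /(src n _ x_k _ in1) y1]] :=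
  get (ALang LRnSn 0 1) ltac:(simpl; tauto).
have [w2 [in2 /(src (n + R) _ x_k _ in2) y2]] :=
  get (ALang LRnSn 0 2) ltac:(simpl; tauto).
have [w3 [[l1 ->] /reach_s s1]] := get (ALang LSstar 3 1) ltac:(simpl; tauto).
have [w5 [[l2 ->] /reach_s s2]] :=
  get (ALang LSstar (3 + R) 2) ltac:(simpl; tauto).
rewrite z0 in s1; rewrite zR in s2.
have [{}y1 le_kn] := y1 (f_equal fst s1).
have [{}y2 _] := y2 (f_equal fst s2).
have /csem_named := get (AConc (name_code NNext) 1) ltac:(simpl; tauto).
have /csem_named := get (AConc (name_code NNotCur) 2) ltac:(simpl; tauto).
rewrite y1 y2 => -[_ not_cur] [n_gt0 next_n]; move: not_cur.
have -> : n + R - k = (n - k) + R by lia.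
by rewrite branch_next_cur.
Qed.

End LoopingCountermodel.

(** * The code of the TBox *)

(** The symbols of a block in prefix order; 4 and 3 are the tags of [CEx] and [CAnd]. *)
Definition block_codes (ops : seq op) : seq nat :=
  flatten [seq [:: 4; role_r; 3; enc_concept (named (NOp o))] | o <- ops].

Lemma enc_block ops C :
  enc_concept (block ops C) = foldr cpair (enc_concept C) (block_codes ops).
Proof.
elim: ops => // o ops IHops.
by rewrite [enc_concept _]/= IHops.
Qed.

Definition input_codes (R : nat) : seq nat :=
  [:: enc_concept CTop, 4, role_root & block_codes (nseq R OInit)].

(** The code depends on [x] only through an iteration count, which is what a loop program can
    reproduce. *)
Lemma enc_input_gci R x : enc_gci (input_gci R x) =
  foldr cpair (iter x (fun y => foldr cpair y (block_codes (ops_at R 0 OInc)))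
                 (enc_concept (named (NPc 0)))) (input_codes R).
Proof.
rewrite /enc_gci [enc_concept (input_gci R x).2]/= enc_block.
by congr (cpair _ (cpair _ (cpair _ (foldr _ _ _)))); elim: x => // x IHx;
  rewrite !iterS enc_block IHx.
Qed.

Theorem theorem5p10 : ~ entailment_decidable.
Proof.
case=> P decides; have [R0 P_regs0] := ex_regs_below P.
(* The encoder uses registers 0 to 7, and [R0] bounds those of [P]. *)
pose R := maxn 8 R0; have R_ge : 8 <= R by rewrite leq_maxl.
have P_regs : regs_below R P.
  by apply: sub_all P_regs0 => i /leq_trans; apply; rewrite leq_maxr.
(* The query depends only on [R], so [D] can contain its code as a constant. *)
pose q := clash_query R.
pose D := diagonal P (block_codes (ops_at R 0 OInc)) (input_codes R)
  (enc_concept (named (NPc 0))) (enc_seq enc_atom q).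
have D_regs : regs_below R D by apply: regs_below_diagonal.
have R_gt0 : 0 < R by lia.
(* The diagonal choice: [x] is the code of the simulation of [D] itself. *)
pose T0 := program_tbox R D; pose x := enc_seq enc_gci T0.
pose T := input_gci R x :: T0.
have enc_T : enc_instance T q = diagonal_input (block_codes (ops_at R 0 OInc))
    (input_codes R) (enc_concept (named (NPc 0))) (enc_seq enc_atom q) x.
  by rewrite /enc_instance /diagonal_input -enc_input_gci.
have [yes no] := decides T q; rewrite enc_T in yes no.
case: (classic (entails T q)) => [ent|not_ent].
  (* Here [P] answers 1, so [D] loops on [x] and the countermodel refutes the entailment. *)
  have D_loops := diagonal_loops _ _ _ _ _ _ (yes ent).
  apply: (countermodel_no_clash R D x R_gt0 D_loops); apply: ent => g [<-|T0_g] d.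
    by move=> _; apply: countermodel_input.
  exact: (countermodel_program _ _ _ R_gt0 D_loops _ T0_g).
(* Here [P] answers 0, so [D] halts on [x], which a model of [T] without a match excludes. *)
apply: (not_ent) => I sat_T; apply: NNPP => no_clash.
have sat_T0 : sat_tbox I T0 by move=> g T0_g; apply: sat_T; right.
have [d] := dom_inhabited I.
apply: (input_not_halting R D I R_gt0 D_regs sat_T0 no_clash x d).
- by rewrite /D size_diagonal.
- exact: (sat_T (input_gci R x) (or_introl erefl)).
by apply: diagonal_halts; apply: no.
Qed.
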